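(* Let $\tau=\{\tau_n\}_{n\ge1}$ be a sequence in $(0,\infty)$ with $\inf_{n\ge1}\tau_n>0$ and $\sup_{n\ge1}\tau_n<\infty$, let $(\mathcal H,\{\Phi_n\}_{n\ge0},B_+^\tau,B_-^\tau)$ be the interacting Fock space associated with the weight $\tau$, and let $\lambda>0$. Then $$\mathfrak{sb}(\mu_{P_\lambda^\tau})=\mu_{C_\lambda^\tau}.$$
   Context: The interacting Fock space with weight $\tau$ consists of a complex Hilbert space $\mathcal H$ with complete orthonormal system $\{\Phi_n\}_{n\ge0}$ and the bounded mutually adjoint operators $B_+^\tau\Phi_n=\sqrt{\tau_{n+1}}\,\Phi_{n+1}$ ($n\ge0$), $B_-^\tau\Phi_n=\sqrt{\tau_n}\,\Phi_{n-1}$ ($n\ge1$), $B_-^\tau\Phi_0=0$. For $\lambda>0$, $$P_\lambda^\tau=(B_+^\tau+\sqrt\lambda I)(B_-^\tau+\sqrt\lambda I),\qquad C_\lambda^\tau=(B_-^\tau+\sqrt\lambda I)(B_+^\tau+\sqrt\lambda I).$$ For a self-adjoint operator $T$ with spectral projections $E_T$, $\mu_T(B)=\langle\Phi_0,E_T(B)\Phi_0\rangle$ for Borel $B\subset\mathbb R$. For a probability measure $\mu$ on $[0,\infty)$ with finite mean $m>0$, the size-biased transform is the probability measure $\mathfrak{sb}(\mu)(dx)=\frac{x\,\mu(dx)}{m}$. *)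

(* Defs.v *)
From HB Require Import structures.
From mathcomp Require Import all_boot all_order all_algebra.
From mathcomp Require Import complex.
From mathcomp Require Import all_classical all_reals all_analysis.

Set Implicit Arguments.
Unset Strict Implicit.
Unset Printing Implicit Defensive.

Import Order.TTheory GRing.Theory Num.Theory.
Import numFieldNormedType.Exports.

Local Open Scope classical_set_scope.
Local Open Scope ring_scope.
Local Open Scope complex_scope.

(* Forms of type [{dot _ for _}] are linear in the first argument and
   conjugate-linear in the second one. *)
Record hilbertSpace (R : realType) := HilbertSpace {
  hilbert_sort :> completeNormedModType R[i] ;
  inner : {dot hilbert_sort for @Num.conj R[i]} ;
  inner_norm : forall x : hilbert_sort, `|x| ^+ 2 = inner x x }.

Arguments inner {R h}.

Section operators.
Context {R : realType} {H : hilbertSpace R}.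

Definition bounded_operator (T : H -> H) : Prop :=
  exists M : R[i], forall x, `|T x| <= M * `|x|.

Definition mutually_adjoint (S T : H -> H) : Prop :=
  forall x y, inner (S x) y = inner x (T y).

Definition complete_orthonormal (Phi : nat -> H) : Prop :=
  (forall m n, inner (Phi m) (Phi n) = (m == n)%:R) /\
  (forall x, (forall n, inner x (Phi n) = 0) -> x = 0).

(* The value [tau 0] is never used: weights are indexed from 1. *)
Record interacting_fock_space (tau : nat -> R) (Phi : nat -> H)
    (Bp Bm : {linear H -> H}) : Prop := InteractingFockSpace {
  ifs_basis : complete_orthonormal Phi ;
  ifs_bounded_creation : bounded_operator Bp ;
  ifs_bounded_annihilation : bounded_operator Bm ;
  ifs_adjoint : mutually_adjoint Bp Bm ;
  ifs_creation : forall n,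
    Bp (Phi n) = (Num.sqrt (tau n.+1))%:C *: Phi n.+1 ;
  ifs_annihilation : forall n, (1 <= n)%N ->
    Bm (Phi n) = (Num.sqrt (tau n))%:C *: Phi n.-1 ;
  ifs_annihilation0 : Bm (Phi 0%N) = 0 }.

Definition shifted (B : H -> H) (lambda : R) : H -> H :=
  fun x => B x + (Num.sqrt lambda)%:C *: x.

Definition P_op (Bp Bm : H -> H) (lambda : R) : H -> H :=
  shifted Bp lambda \o shifted Bm lambda.

Definition C_op (Bp Bm : H -> H) (lambda : R) : H -> H :=
  shifted Bm lambda \o shifted Bp lambda.

End operators.

(* A projection-valued measure on the Borel sets of [R].  As for the measures
   of the library, it is a total function of the set, constrained off the
   Borel sets only by a positivity condition (here: being a projection). *)
Record projection_valued_measure (R : realType) (H : hilbertSpace R) := PVM {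
  pvm :> set R -> {linear H -> H} ;
  pvm_idem : forall B x, pvm B (pvm B x) = pvm B x ;
  pvm_adj : forall B, mutually_adjoint (pvm B) (pvm B) ;
  pvm_set0 : forall x, pvm set0 x = 0 ;
  pvm_setT : forall x, pvm setT x = x ;
  pvm_setI : forall A B, measurable A -> measurable B ->
    forall x, pvm A (pvm B x) = pvm (A `&` B) x ;
  pvm_bigcup : forall F : (set R)^nat, (forall n, measurable (F n)) ->
    trivIset setT F ->
    forall x, (fun n => \sum_(0 <= i < n) pvm (F i) x) @ \oo -->
              pvm (\bigcup_n F n) x }.

Section spectral_law.
Context {R : realType} {H : hilbertSpace R}.
Variables (E : projection_valued_measure H) (x : H).

Definition spectral_law (B : set R) : \bar R :=
  (complex.Re (inner x (E B x)))%:E.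

Lemma inner_pvm B : inner x (E B x) = `|E B x| ^+ 2.
Proof. by rewrite inner_norm (pvm_adj E B) pvm_idem. Qed.

Let spectral_law0 : spectral_law set0 = 0%E.
Proof. by rewrite /spectral_law inner_pvm pvm_set0 normr0 expr0n. Qed.

Let spectral_law_ge0 B : (0 <= spectral_law B)%E.
Proof.
rewrite lee_fin inner_pvm.
have : 0 <= `|E B x| ^+ 2 by rewrite exprn_ge0.
by rewrite lecE => /andP[].
Qed.

Let inner_sum_pvm (F : (set R)^nat) n : (forall k, measurable (F k)) ->
  trivIset setT F ->
  \sum_(0 <= i < n) inner x (E (F i) x) =
  `|\sum_(0 <= i < n) E (F i) x| ^+ 2.
Proof.
move=> mF tF; rewrite inner_norm linear_sumlz.
apply: eq_big_nat => i /andP[_ lin].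
apply/esym/(etrans (pvm_adj E _ _ _)).
rewrite linear_sum /= (bigD1_seq i) ?mem_index_iota ?iota_uniq //=.
rewrite pvm_idem big1 ?addr0 // => j ji.
rewrite pvm_setI //.
have [->|/set0P Fij] := eqVneq (F i `&` F j) set0; first exact: pvm_set0.
by move/eqP: ji; rewrite (tF j i I I)//; rewrite setIC.
Qed.

Let spectral_law_sigma : semi_sigma_additive spectral_law.
Proof.
move=> F mF tF _.
have /cvg_norm h := @pvm_bigcup _ _ E F mF tF x.
have {}h := cvgM h h; move/(_ _)/(@cvgrPdist_lt _ R[i]^o) : h => h.
rewrite [X in X @ \oo --> _](_ : _ = EFin \o (fun n =>
    complex.Re (`|\sum_(0 <= i < n) E (F i) x| ^+ 2))); last first.
  apply/funext => n /=; rewrite sumEFin -inner_sum_pvm //.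
  by rewrite (raddf_sum (@complex.Re R)).
apply: cvg_EFin; first exact: nearW.
apply/cvgrPdist_lt => e e0.
have e0C : 0 < e%:C by rewrite ltcR.
have := h _ e0C.
apply: filterS => n.
rewrite inner_pvm /= -raddfB /= -ltcR; apply: le_lt_trans.
by rewrite -!expr2; apply: normc_ge_Re.
Qed.

HB.instance Definition _ := isMeasure.Build _ _ _ spectral_law
  spectral_law0 spectral_law_ge0 spectral_law_sigma.

End spectral_law.

(* [T] is the integral of [t] against [E], in the weak sense
   <x, T x> = \int t <x, E(dt) x> for all x; by polarization the diagonal
   determines the sesquilinear form <x, T y>.  By the spectral theorem a bounded
   self-adjoint [T] has such an [E], unique on the Borel sets. *)
Definition is_spectral_measure (R : realType) (H : hilbertSpace R)
    (T : H -> H) (E : projection_valued_measure H) : Prop :=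
  forall x,
    (spectral_law E x).-integrable setT (fun t : R => t%:E) /\
    inner x (T x) = (\int[spectral_law E x]_t t)%:C.

Section size_biased.
Context {R : realType}.
Local Open Scope ereal_scope.

Definition mean (mu : {measure set R -> \bar R}) : \bar R :=
  \int[mu]_x x%:E.

(* Probability measures on [0, +oo[ with a finite positive mean; outside of
   this class [size_biased] has no meaning. *)
Definition size_biasable (mu : {measure set R -> \bar R}) : Prop :=
  [/\ mu setT = 1, mu [set x | (x < 0)%R] = 0, 0 < mean mu & mean mu < +oo].

Definition size_biased (mu : {measure set R -> \bar R}) (B : set R) : \bar R :=
  ((fine (mean mu))^-1)%:E * \int[mu]_(x in B) x%:E.

End size_biased.

(* Main.v *)
Require Import Defs.
From HB Require Import structures.
From mathcomp Require Import all_boot all_order all_algebra.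
From mathcomp Require Import complex ring lra.
From mathcomp Require Import all_classical all_reals all_analysis.
From mathcomp Require Import measurable_realfun.

Set Implicit Arguments.
Unset Strict Implicit.
Unset Printing Implicit Defensive.

Import Order.TTheory GRing.Theory Num.Theory.
Import numFieldNormedType.Exports.

Local Open Scope classical_set_scope.
Local Open Scope ring_scope.

(** Put S = B_- + sqrt lambda, with adjoint S'.  Then P = S' S and C = S S',
    so S P = C S.  The same intertwining passes to the spectral projections,
    S E_P(B) = E_C(B) S ([pvm_intertwine]), and the theorem follows from it:
    for a Borel set B and the vacuum Phi_0,
      \int_B t d mu_P = <E_P(B) Phi_0, S' S E_P(B) Phi_0> = |S E_P(B) Phi_0|^2
                      = |E_C(B) S Phi_0|^2 = lambda |E_C(B) Phi_0|^2
                      = lambda mu_C(B),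
    because S Phi_0 = sqrt lambda Phi_0.  Taking B = R, the mean of mu_P is
    lambda, and dividing by it gives the size-biased transform.

    The intertwining is obtained without functional calculus.  The measure E_P
    is only known through the quadratic form of P, so the first step extracts
    from it that P commutes with its projections ([pvm_comm]: the form splits
    over B and its complement, then polarization), and that P is at most a on
    the range of E_P(t <= a) and at least b on the range of E_P(t >= b), in
    norm ([sqnorm_op_le], [sqnorm_op_ge]).  Then, for a < b, let
    X = E_P(t > b) S' E_C(t <= a).  Since P X = X C, where P expands by
    at least b on the range of X while C is bounded by a on its domain,
    b^n |X y| <= |P^n X y| = |X C^n y| <= const * a^n, so X = 0
    ([pvm_halflines_cross_lt]).  Letting b decrease to a, S' maps the range of
    E_C(t <= a) into that of E_P(t <= a); by symmetry S maps the range of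
    E_P(t <= a) into that of E_C(t <= a), and adjunction turns these two
    inclusions into an exact intertwining on half-lines.  Half-lines form a
    pi-system generating the Borel sets, which gives all Borel sets. *)

(** * The squared norm of a Hilbert space *)

Section squared_norm.
Local Open Scope complex_scope.
Context {R : realType} {H : hilbertSpace R}.
Implicit Types x y z : H.

(** The squared norm as an element of [R] rather than [R[i]], so that the
    estimates below are inequalities in a totally ordered field. *)
Definition sqnorm x : R := complex.Re (inner x x).

Lemma innerxx x : inner x x = (sqnorm x)%:C.
Proof.
by rewrite /sqnorm -inner_norm RRe_real// ger0_real// exprn_ge0.
Qed.

Lemma sqnorm_ge0 x : 0 <= sqnorm x.
Proof. by rewrite -lecR -innerxx -inner_norm exprn_ge0. Qed.

Lemma sqnorm_eq0 x : sqnorm x = 0 -> x = 0.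
Proof.
move=> x0; apply/eqP; rewrite -normr_eq0 -sqrf_eq0 inner_norm innerxx x0.
by [].
Qed.

Lemma sqnorm0 : sqnorm 0 = 0.
Proof. by rewrite /sqnorm linear0l. Qed.

Lemma innerC x y : inner x y = (inner y x)^*.
Proof. by rewrite hermC expr0 mul1r. Qed.

Lemma Re_innerC x y : complex.Re (inner x y) = complex.Re (inner y x).
Proof. by rewrite innerC; case: (inner y x). Qed.

Lemma sqnormD x y :
  sqnorm (x + y) = sqnorm x + complex.Re (inner x y) *+ 2 + sqnorm y.
Proof.
rewrite /sqnorm linearDl !linearDr !raddfD /= (Re_innerC y x).
by rewrite mulr2n !addrA.
Qed.

Lemma sqnormZ (a : R) x : sqnorm (a%:C *: x) = a ^+ 2 * sqnorm x.
Proof.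
rewrite /sqnorm linearZl linearZr_LR /=.
rewrite innerxx /=; ring.
Qed.

Lemma sqnormBZ (a : R) x y : sqnorm (a%:C *: x - y) =
  a ^+ 2 * sqnorm x - a * complex.Re (inner x y) *+ 2 + sqnorm y.
Proof.
rewrite sqnormD sqnormZ (linearNr _ (a%:C *: x)) (linearZl y).
rewrite [sqnorm (- y)]/sqnorm linearNl linearNr opprK -/(sqnorm y) /=.
case: (inner x y) => u v /=; ring.
Qed.

Lemma inner_injr x y : (forall z, inner z x = inner z y) -> x = y.
Proof.
move=> h; apply/eqP; rewrite -subr_eq0; apply/eqP/sqnorm_eq0.
by rewrite /sqnorm linearBr /= h subrr.
Qed.

Lemma mutually_adjoint_sym (S T : H -> H) :
  mutually_adjoint S T -> mutually_adjoint T S.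
Proof. by move=> adj x y; rewrite innerC -adj -innerC. Qed.

Lemma bounded_operator_continuous (S : {linear H -> H}) :
  bounded_operator S -> continuous S.
Proof.
move=> [M SM]; apply/linear_bounded_continuous/linear_boundedP.
(* The order of [R[i]] is partial: [M] may fail to be real when [H] is null,
   hence the passage to [`|M|]. *)
have {}SM x : `|S x| <= `|M| * `|x|.
  have Mx0 : 0 <= M * `|x| by apply: le_trans (SM x).
  by rewrite -[leRHS]ger0_norm ?mulr_ge0// normrM normr_id -normrM ger0_norm.
near=> r => x; by apply: le_trans (SM x) _; apply: ler_wpM2r.
Unshelve. all: by end_near.
Qed.

End squared_norm.

(** * Projection-valued measures *)

Section pvm.
Local Open Scope complex_scope.
Context {R : realType} {H : hilbertSpace R} (E : projection_valued_measure H).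
Implicit Types (x y z : H) (A B : set R).

Lemma spectral_lawE B x : spectral_law E x B = (sqnorm (E B x))%:E.
Proof. by rewrite /spectral_law inner_pvm inner_norm. Qed.

(** Finite additivity is recovered from countable additivity: the partial sums
    of the sequence [B, ~` B, set0, set0, ...] are eventually constant. *)
Lemma pvm_addC B x : measurable B -> E B x + E (~` B) x = x.
Proof.
move=> mB.
have mF n : measurable (bigcup2 B (~` B) n).
  by case: n => [|[|n]] //=; exact: measurableC.
have tF : trivIset setT (bigcup2 B (~` B)).
  by rewrite -trivIset_bigcup2 setICr.
have := @pvm_bigcup _ _ E _ mF tF x; rewrite bigcup2E setUv pvm_setT => h.
apply/esym; apply: (@cvg_unique _ (@norm_hausdorff _ H) _ _ _ _ h).
apply: cvg_near_cst; exists 2%N => // n /= n2.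
rewrite -(subnKC n2) big_nat_recl//= big_nat_recl//= big1 ?addr0// => i _.
by rewrite pvm_set0.
Qed.

Lemma pvm_setC B x : measurable B -> E (~` B) x = x - E B x.
Proof. by move=> mB; rewrite -{2}(pvm_addC x mB) addrAC subrr add0r. Qed.

Lemma pvm_complK B x : measurable B -> E (~` B) (E B x) = 0.
Proof. by move=> mB; rewrite pvm_setC// pvm_idem subrr. Qed.

Lemma sqnorm_pvm_le B x : measurable B -> sqnorm (E B x) <= sqnorm x.
Proof.
move=> mB; rewrite -{2}(pvm_addC x mB) sqnormD.
rewrite (pvm_adj E B x) pvm_setC//.
rewrite linearB /= pvm_idem subrr linear0r mul0rn addr0 lerDl.
exact: sqnorm_ge0.
Qed.

(** Projecting the vector restricts its law; this is how integrals over [B] are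
    turned into values of the quadratic form. *)
Lemma spectral_law_pvm A B x : measurable A -> measurable B ->
  spectral_law E (E B x) A = spectral_law E x (A `&` B).
Proof. by move=> mA mB; rewrite !spectral_lawE pvm_setI. Qed.

Lemma pvm_null_bigcup (F : (set R)^nat) x : (forall n, measurable (F n)) ->
  (forall n, E (F n) x = 0) -> E (\bigcup_n F n) x = 0.
Proof.
move=> mF F0; apply: sqnorm_eq0; apply: EFin_inj; rewrite -spectral_lawE.
have mU : measurable (\bigcup_n F n) by exact: bigcup_measurable.
apply/(@negligibleP _ _ _ (spectral_law E x) _ mU)/negligible_bigcup => n.
apply/(@negligibleP _ _ _ (spectral_law E x) _ (mF n)).
by apply: etrans (spectral_lawE _ _) _; rewrite F0 sqnorm0.
Qed.

End pvm.

(** * Spectral subspaces of a positive operator [S' \o S] *)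

Section positive_operator.
Local Open Scope complex_scope.
Context {R : realType} {H : hilbertSpace R}.
Variables (S S' : {linear H -> H}) (E : projection_valued_measure H).
Hypothesis adjSS' : mutually_adjoint S S'.
Hypothesis hE : is_spectral_measure (S' \o S) E.
Implicit Types (x y z : H) (a b : R) (B : set R).

Lemma integrable_spectral_law B x : measurable B ->
  (spectral_law E x).-integrable B (fun t : R => t%:E).
Proof. by move=> mB; apply: (integrableS measurableT) => //; case: (hE x). Qed.

(** The weak integral formula for [S' \o S], with <x, S' S x> = |S x|^2. *)
Lemma sqnorm_int x : sqnorm (S x) = \int[spectral_law E x]_t t.
Proof. by rewrite /sqnorm adjSS'; have [_ /= ->] := hE x. Qed.

(** The law of [E B x] is that of [x] restricted to [B], so that the integral
    over the complement of [B] vanishes. *)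
Lemma sqnorm_int_pvm B x : measurable B ->
  sqnorm (S (E B x)) = \int[spectral_law E x]_(t in B) t.
Proof.
move=> mB; have mBC := measurableC mB.
rewrite sqnorm_int -{1}(setUv B) Rintegral_setU//; last 2 first.
- by rewrite setUv; exact: integrable_spectral_law.
- by rewrite disj_set2E setICr.
rewrite [X in _ + X](_ : _ = 0) ?addr0; last first.
  rewrite /Rintegral null_set_integral//.
  by apply: etrans (spectral_lawE _ _ _) _; rewrite pvm_complK// sqnorm0.
congr fine; apply: eq_measure_integral => A mA AB.
by rewrite [LHS]spectral_law_pvm// (setIidl AB).
Qed.

Lemma sqnorm_pvm_split B x : measurable B ->
  sqnorm (S x) = sqnorm (S (E B x)) + sqnorm (S (E (~` B) x)).
Proof.
move=> mB; have mBC := measurableC mB.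
rewrite !sqnorm_int_pvm// sqnorm_int -{1}(setUv B) Rintegral_setU//.
- by rewrite setUv; exact: integrable_spectral_law.
- by rewrite disj_set2E setICr.
Qed.

Lemma sqnorm_pvm_le_mul B a x : measurable B -> (forall t, B t -> t <= a) ->
  sqnorm (S (E B x)) <= a * sqnorm (E B x).
Proof.
move=> mB Ba; rewrite sqnorm_int_pvm//.
apply: (@le_trans _ _ (\int[spectral_law E x]_(t in B) a)).
  apply: le_Rintegral => //; first exact: integrable_spectral_law.
  apply: measurable_bounded_integrable => //.
    by apply: le_lt_trans (ltry (sqnorm (E B x))); rewrite [leLHS]spectral_lawE.
  exact: (bounded_cst a).
by rewrite Rintegral_cst// [X in fine X]spectral_lawE.
Qed.

Lemma sqnorm_pvm_ge_mul B a x : measurable B -> (forall t, B t -> a <= t) ->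
  a * sqnorm (E B x) <= sqnorm (S (E B x)).
Proof.
move=> mB Ba; rewrite sqnorm_int_pvm//.
apply: (@le_trans _ _ (\int[spectral_law E x]_(t in B) a)); last first.
  apply: le_Rintegral => //; last exact: integrable_spectral_law.
  apply: measurable_bounded_integrable => //.
    by apply: le_lt_trans (ltry (sqnorm (E B x))); rewrite [leLHS]spectral_lawE.
  exact: (bounded_cst a).
by rewrite Rintegral_cst// [X in fine X]spectral_lawE.
Qed.

(** By [sqnorm_pvm_split] the cross terms of the form vanish on every sum
    [E B u + E (~` B) v], that is, the real part of the inner product is [0];
    replacing [u] by ['i *: u] kills the imaginary part as well. *)
Lemma pvm_form_orthogonal B x y : measurable B ->
  inner (S (E B x)) (S (E (~` B) y)) = 0.
Proof.
move=> mB; have mBC := measurableC mB.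
have re (u v : H) : complex.Re (inner (S (E B u)) (S (E (~` B) v))) = 0.
  have := sqnorm_pvm_split (E B u + E (~` B) v) mB.
  have -> : E B (E B u + E (~` B) v) = E B u.
    by rewrite linearD /= pvm_idem pvm_setI// setICr pvm_set0 addr0.
  have -> : E (~` B) (E B u + E (~` B) v) = E (~` B) v.
    by rewrite linearD /= pvm_idem pvm_setI// setICl pvm_set0 add0r.
  by rewrite linearD sqnormD /= => h; lra.
have := re x y; have := re ('i *: x) y.
rewrite !linearZ /= linearZl /=.
case: (inner _ _) => u v /= h1 h2; apply/eqP; rewrite eq_complex /=.
by apply/andP; split; apply/eqP; lra.
Qed.

(** Both off-diagonal blocks of [S' \o S] with respect to [E B] and [E (~` B)]
    vanish by [pvm_form_orthogonal]. *)
Lemma pvm_comm B x : measurable B -> E B (S' (S x)) = S' (S (E B x)).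
Proof.
move=> mB; have mBC := measurableC mB.
have off C u : measurable C -> E (~` C) (S' (S (E C u))) = 0.
  move=> mC; apply: sqnorm_eq0; rewrite /sqnorm (pvm_adj E) pvm_idem.
  by rewrite Re_innerC -adjSS' Re_innerC pvm_form_orthogonal.
rewrite -{1}(pvm_addC E x mB) !linearD /=.
have := off (~` B) x mBC; rewrite setCK => ->; rewrite addr0.
by rewrite -[RHS](pvm_addC E _ mB) off// addr0.
Qed.

(** From the form bound to a norm bound.  For z in the range of [E B] and
    T = S' S, the vector T z is in that range too, so |S z|^2 <= a |z|^2 and
    |S T z|^2 <= a |T z|^2.  Since <S z, S T z> = |T z|^2, expanding
    0 <= |a S z - S T z|^2 gives a |T z|^2 <= a^3 |z|^2. *)
Lemma sqnorm_op_le B a x : measurable B -> 0 <= a ->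
    (forall t, B t -> t <= a) ->
  sqnorm (S' (S (E B x))) <= a ^+ 2 * sqnorm (E B x).
Proof.
move=> mB a0 Ba; have SE := sqnorm_pvm_le_mul x mB Ba.
move: a0; rewrite le_eqVlt => /predU1P[a0|a0].
  have -> : S (E B x) = 0.
    apply: sqnorm_eq0; apply/eqP.
    by rewrite eq_le sqnorm_ge0 andbT (le_trans SE)// -a0 mul0r.
  by rewrite linear0 sqnorm0 -a0 expr0n mul0r.
have := sqnorm_pvm_le_mul (S' (S x)) mB Ba; rewrite pvm_comm// => STE.
have := sqnorm_ge0 (a%:C *: S (E B x) - S (S' (S (E B x)))).
rewrite sqnormBZ Re_innerC adjSS' -/(sqnorm _).
set p := sqnorm (S _) in SE *; set q := sqnorm (S' _) in STE *.
set r := sqnorm (S _) in STE *; set n := sqnorm _ in SE * => h.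
by rewrite -(ler_pM2l a0); nra.
Qed.

(** Expanding 0 <= |b z - T z|^2 with b |z|^2 <= <z, T z>. *)
Lemma sqnorm_op_ge B b x : measurable B -> 0 <= b ->
    (forall t, B t -> b <= t) ->
  b ^+ 2 * sqnorm (E B x) <= sqnorm (S' (S (E B x))).
Proof.
move=> mB b0 Bb; have SE := sqnorm_pvm_ge_mul x mB Bb.
have := sqnorm_ge0 (b%:C *: E B x - S' (S (E B x))).
rewrite sqnormBZ -adjSS' -/(sqnorm _).
set p := sqnorm (S _) in SE *; set q := sqnorm (S' _).
set n := sqnorm _ in SE * => h; nra.
Qed.

(** On the range of [E] of the half-line t <= - 1/n, the form |S z|^2 is at most
    - |z|^2 / n, which forces z = 0. *)
Lemma pvm_neg x : E [set t | t < 0] x = 0.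
Proof.
have -> : [set t : R | t < 0] = \bigcup_n [set` `]-oo, - n.+1%:R^-1]].
  apply/seteqP; split => t /=.
    move=> t0; exists (Num.truncn (- t)^-1) => //=; rewrite in_itv /= lerNr.
    rewrite -[leRHS]invrK lef_pV2 ?posrE ?invr_gt0 ?oppr_gt0//.
    by apply/ltW/truncnS_gt.
  move=> [n _]; rewrite /= in_itv /= => /le_lt_trans; apply.
  by rewrite oppr_lt0 invr_gt0.
apply: pvm_null_bigcup => [n|n]; first exact: measurable_itv.
apply: sqnorm_eq0; apply/eqP; rewrite eq_le sqnorm_ge0 andbT.
have := @sqnorm_pvm_le_mul _ (- n.+1%:R^-1) x
  (measurable_itv `]-oo, - n.+1%:R^-1]).
have le_in (t : R) : [set` `]-oo, - n.+1%:R^-1]] t -> t <= - n.+1%:R^-1.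
  by rewrite /= in_itv.
move=> /(_ le_in) /(le_trans (sqnorm_ge0 _)).
by rewrite mulNr oppr_ge0 pmulr_rle0.
Qed.

End positive_operator.

(** * Intertwining of the spectral projections of [S' \o S] and [S \o S'] *)

(** The comparison of growth rates that concludes the iteration in
    [pvm_halflines_cross_lt]. *)
Lemma geometric_le0 (R : realType) (p q c K : R) : 0 <= p -> p < q ->
  (forall n, q ^+ n * c <= p ^+ n * K) -> c <= 0.
Proof.
move=> p0 pq h; have q0 : 0 < q by apply: le_lt_trans pq.
have : (fun n => geometric K (p / q) n) @ \oo --> (0 : R).
  apply: cvg_geometric.
  by rewrite ger0_norm ?divr_ge0 ?(ltW q0)// ltr_pdivrMr ?mul1r.
move=> /cvgr_to_ge; apply; apply: nearW => n /=.
by rewrite expr_div_n mulrA ler_pdivlMr ?exprn_gt0// mulrC (mulrC K).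
Qed.

Section intertwining.
Context {R : realType} {H : hilbertSpace R}.

(** Write X for the operator on the left and C = S S'.  Each step of the
    induction applies [S' \o S] to X y, which multiplies its squared norm by at
    least b^2, and rewrites the result as X C y, where C multiplies squared norms
    by at most a^2 on the range of [F] of the half-line. *)
Lemma pvm_halflines_cross_lt (S S' : {linear H -> H})
    (E F : projection_valued_measure H) (a b : R) (y : H) :
  mutually_adjoint S S' ->
  is_spectral_measure (S' \o S) E -> is_spectral_measure (S \o S') F ->
  a < b -> E `]b, +oo[%classic (S' (F `]-oo, a]%classic y)) = 0.
Proof.
move=> adj hE hF ab; have adj' := mutually_adjoint_sym adj.
have mI : measurable `]-oo, a]%classic by exact: measurable_itv.
have mJ : measurable `]b, +oo[%classic by exact: measurable_itv.
have Ia (t : R) : `]-oo, a]%classic t -> t <= a by rewrite /= in_itv.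
(* The growth argument needs [0 <= a]; below zero there is no spectrum. *)
have [a0|a0] := ltP a 0.
  have -> : F `]-oo, a]%classic y = 0.
    rewrite -(pvm_neg adj' hF (F `]-oo, a]%classic y)) pvm_setI//.
      congr (F _ y); apply/esym/setIidr => t /Ia /= ta.
      exact: le_lt_trans a0.
    by rewrite -[X in measurable X]set_itvNyo; exact: measurable_itv.
  by rewrite !linear0.
have b0 : 0 <= b := ltW (le_lt_trans a0 ab).
have Jb (t : R) : `]b, +oo[%classic t -> b <= t.
  by rewrite /= in_itv /= andbT => /ltW.
apply: sqnorm_eq0; apply/eqP; rewrite eq_le sqnorm_ge0 andbT.
apply: (@geometric_le0 _ (a ^+ 2) (b ^+ 2) _
  (a * sqnorm (F `]-oo, a]%classic y))).
- exact: exprn_ge0.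
- by rewrite ltr_pXn2r.
move=> n; elim: n y => [|n IHn] y.
  rewrite !mul1r; apply: le_trans (sqnorm_pvm_le _ _ mJ) _.
  exact: sqnorm_pvm_le_mul.
rewrite exprSr -mulrA.
apply: (@le_trans _ _ ((b ^+ 2) ^+ n *
    sqnorm (E `]b, +oo[%classic (S' (F `]-oo, a]%classic (S (S' y))))))).
  apply: ler_wpM2l; first by rewrite !exprn_ge0.
  rewrite (pvm_comm adj' hF)// (pvm_comm adj hE)//.
  exact: sqnorm_op_ge.
apply: le_trans (IHn _) _.
rewrite [X in _ <= X * _]exprSr -[leRHS]mulrA.
apply: ler_wpM2l; first by rewrite !exprn_ge0.
rewrite [leRHS]mulrCA; apply: ler_wpM2l => //.
by rewrite (pvm_comm adj' hF)//; exact: sqnorm_op_le.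
Qed.

Lemma pvm_halflines_cross (S S' : {linear H -> H})
    (E F : projection_valued_measure H) (a : R) (y : H) :
  mutually_adjoint S S' ->
  is_spectral_measure (S' \o S) E -> is_spectral_measure (S \o S') F ->
  E `]a, +oo[%classic (S' (F `]-oo, a]%classic y)) = 0.
Proof.
move=> adj hE hF.
have -> : `]a, +oo[%classic = \bigcup_n `]a + n.+1%:R^-1, +oo[%classic.
  apply/seteqP; split => t /=; rewrite in_itv /= andbT.
    rewrite -subr_gt0 => ta; exists (Num.truncn (t - a)^-1) => //=.
    rewrite in_itv /= andbT -ltrBrDl -[ltRHS]invrK ltf_pV2 ?posrE ?invr_gt0//.
    exact: truncnS_gt.
  move=> [n _]; rewrite /= in_itv /= andbT; apply: le_lt_trans.
  by rewrite lerDl invr_ge0.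
apply: pvm_null_bigcup => n; first exact: measurable_itv.
by apply: pvm_halflines_cross_lt adj hE hF _; rewrite ltrDl invr_gt0.
Qed.

Lemma pvm_halflines_sub (S S' : {linear H -> H})
    (E F : projection_valued_measure H) (a : R) (y : H) :
  mutually_adjoint S S' ->
  is_spectral_measure (S' \o S) E -> is_spectral_measure (S \o S') F ->
  E `]-oo, a]%classic (S' (F `]-oo, a]%classic y)) = S' (F `]-oo, a]%classic y).
Proof.
move=> adj hE hF.
rewrite -[RHS](pvm_addC E _ (measurable_itv `]-oo, a])) setCitvl.
by rewrite (pvm_halflines_cross _ _ adj hE hF) addr0.
Qed.

Variables (S S' : {linear H -> H}) (E F : projection_valued_measure H).
Hypothesis adj : mutually_adjoint S S'.
Hypothesis bS : bounded_operator S.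
Hypothesis hE : is_spectral_measure (S' \o S) E.
Hypothesis hF : is_spectral_measure (S \o S') F.

(** The inclusion of ranges for [S] gives S E = F S E, the one for [S'] gives
    S' F = E S' F, whose adjoint is F S = F S E. *)
Lemma pvm_intertwine_halfline (a : R) x :
  S (E `]-oo, a]%classic x) = F `]-oo, a]%classic (S x).
Proof.
have adj' := mutually_adjoint_sym adj.
rewrite -(pvm_halflines_sub _ _ adj' hF hE).
apply: inner_injr => z.
rewrite -(pvm_adj F) -adj' -(pvm_adj E) (pvm_halflines_sub _ _ adj hE hF).
by rewrite adj' (pvm_adj F).
Qed.

(** The Borel sets for which the equality holds form a Dynkin system; stability
    under countable disjoint unions uses the continuity of [S]. *)
Lemma pvm_intertwine B x : measurable B -> S (E B x) = F B (S x).
Proof.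
move=> mB; move: B mB x.
have GE : @measurable _ R = <<s @RGenOInfty.G R >>.
  exact: RGenOInfty.measurableE.
move=> B; rewrite {1}GE.
apply: (dynkin_induction (P := fun B => forall x, S (E B x) = F B (S x)) GE).
- move=> _ _ [a ->] [b ->]; exists (Num.max a b).
  by apply/seteqP; split => t /=; rewrite !in_itv /= !andbT gt_max;
    [case=> -> -> | move/andP].
- by move=> x; rewrite !pvm_setT.
- move=> _ [a ->] x; rewrite -setCitvl !pvm_setC//.
  by rewrite linearB /= pvm_intertwine_halfline.
- by move=> C mC CP x; rewrite !pvm_setC// linearB /= CP.
move=> G mG tG GP x.
have := @pvm_bigcup _ _ F G mG tG (S x).
have := @pvm_bigcup _ _ E G mG tG x.
move=> /(continuous_cvg _ (@bounded_operator_continuous _ _ _ bS _)) h1 h2.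
apply: (@cvg_unique _ (@norm_hausdorff _ H) _ _ _ _ h1).
apply: cvg_trans h2; apply: near_eq_cvg; apply: nearW => n.
by rewrite /= (linear_sum S); apply: eq_bigr => i _; rewrite GP.
Qed.

(** The size-biasing principle for a general vector: weighting by [t] the law of
    [x] under [S' \o S] gives the law of [S x] under [S \o S']. *)
Lemma integral_spectral_law B x : measurable B ->
  (\int[spectral_law E x]_(t in B) t%:E = spectral_law F (S x) B)%E.
Proof.
move=> mB; rewrite -[LHS]fineK; last first.
  by apply: integrable_fin_num => //; exact: integrable_spectral_law hE _ _ _.
rewrite [fine _](esym (sqnorm_int_pvm adj hE x mB)) pvm_intertwine//.
by rewrite -spectral_lawE.
Qed.

End intertwining.

(** * The shifted annihilation and creation operators *)

Section shifted_operator.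
Local Open Scope complex_scope.
Context {R : realType} {H : hilbertSpace R}.
Implicit Types (lambda : R).

Section linear.
Variables (B : {linear H -> H}) (lambda : R).

Let shifted_linear : linear (shifted B lambda).
Proof.
move=> k x y; rewrite /shifted linearP !scalerDr !scalerA (mulrC k) addrACA.
by [].
Qed.

HB.instance Definition _ :=
  GRing.isLinear.Build R[i] H H *:%R (shifted B lambda) shifted_linear.

End linear.

Lemma shifted_adjoint (B B' : {linear H -> H}) lambda :
  mutually_adjoint B B' ->
  mutually_adjoint (shifted B lambda) (shifted B' lambda).
Proof.
move=> adj x y; rewrite /shifted (linearDl _ y) (linearDr _ x).
congr (_ + _); first exact: adj.
by rewrite (linearZl y) (linearZr_LR _ x) /= [X in _ = X * _]conjc_real.
Qed.

Lemma shifted_bounded (B : {linear H -> H}) lambda :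
  bounded_operator B -> bounded_operator (shifted B lambda).
Proof.
move=> [M BM]; exists (M + `|(Num.sqrt lambda)%:C|) => x.
rewrite mulrDl -normrZ; apply: le_trans (ler_normD _ _) _.
by rewrite lerD2r.
Qed.

End shifted_operator.

Theorem theorem4p1 (R : realType) (H : hilbertSpace R) (tau : nat -> R)
  (Phi : nat -> H) (Bp Bm : {linear H -> H}) (lambda : R)
  (EP EC : projection_valued_measure H)
  (tau_gt0 : forall n, (1 <= n)%N -> 0 < tau n)
  (tau_inf : (0 < ereal_inf [set (tau n)%:E | n in [set n | (1 <= n)%N]])%E)
  (tau_sup : (ereal_sup [set (tau n)%:E | n in [set n | (1 <= n)%N]] < +oo)%E)
  (fock : interacting_fock_space tau Phi Bp Bm)
  (lambda_gt0 : 0 < lambda)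
  (hEP : is_spectral_measure (P_op Bp Bm lambda) EP)
  (hEC : is_spectral_measure (C_op Bp Bm lambda) EC) :
  size_biasable (spectral_law EP (Phi 0%N)) /\
  forall B : set R, measurable B ->
    size_biased (spectral_law EP (Phi 0%N)) B = spectral_law EC (Phi 0%N) B.
Proof.
case: fock => -[Phi_orth _] _ bBm adj _ _ Bm0.
have adjS : mutually_adjoint (shifted Bp lambda) (shifted Bm lambda).
  exact: shifted_adjoint.
have adjS' := mutually_adjoint_sym adjS.
have bS := shifted_bounded lambda bBm.
have Phi1 : sqnorm (Phi 0%N) = 1 by rewrite /sqnorm Phi_orth.
have SPhi0 : shifted Bm lambda (Phi 0%N) = (Num.sqrt lambda)%:C%C *: Phi 0%N.
  by rewrite /shifted Bm0 add0r.
have biasE B : measurable B ->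
    (\int[spectral_law EP (Phi 0%N)]_(t in B) t%:E =
     lambda%:E * spectral_law EC (Phi 0%N) B)%E.
  move=> mB; rewrite (integral_spectral_law adjS' bS hEP hEC)//.
  rewrite [LHS]spectral_lawE [X in (_ * X)%E]spectral_lawE.
  by rewrite [X in EC B X]SPhi0 linearZ /= sqnormZ sqr_sqrtr ?ltW// EFinM.
have meanE : mean (spectral_law EP (Phi 0%N)) = lambda%:E.
  rewrite [LHS]biasE//.
  by rewrite [X in (_ * X)%E]spectral_lawE pvm_setT Phi1 mule1.
split; first split.
- by rewrite [LHS]spectral_lawE pvm_setT Phi1.
- by rewrite [LHS]spectral_lawE (pvm_neg adjS' hEP) sqnorm0.
- by rewrite meanE lte_fin.
- by rewrite meanE ltry.
move=> B mB; rewrite /size_biased meanE biasE// muleA -EFinM /=.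
by rewrite mulVf ?lt0r_neq0// mul1r.
Qed.
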